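(* Let $G$ and $H$ be finite simple connected graphs, each with at least two vertices. If $o(H)\in\{\mathcal{N},\mathcal{S}\}$, then $o(G\circ H)=\mathcal{S}$.
   Context: The lexicographic product $G\circ H$ has vertex set $V(G)\times V(H)$, with $(g,h)(g',h')$ an edge iff $gg'\in E(G)$, or $g=g'$ and $hh'\in E(H)$. A set $W\subseteq V(X)$ is a resolving set of a connected graph $X$ if for every two distinct vertices $x,y$ there is $z\in W$ with $d(x,z)\ne d(y,z)$. In the Maker-Breaker resolving game on $X$, Resolver and Spoiler alternately select unplayed vertices of $X$; Resolver wins if the vertices he selects contain a resolving set of $X$, and Spoiler wins if she selects at least one vertex of every resolving set of $X$. The outcome $o(X)$ is $\mathcal{R}$ if Resolver has a winning strategy no matter who starts, $\mathcal{S}$ if Spoiler has a winning strategy no matter who starts, and $\mathcal{N}$ if the first player has a winning strategy. *)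

(* Defs.v *)
From HB Require Import structures.
From mathcomp Require Import all_boot.

Set Implicit Arguments.
Unset Strict Implicit.
Unset Printing Implicit Defensive.

Record sgraph := SGraph {
  vertex :> finType;
  adj : rel vertex;
  adj_sym : symmetric adj;
  adj_irrefl : irreflexive adj
}.

Definition connected (X : sgraph) : Prop :=
  forall x y : X, connect (@adj X) x y.

Definition walk_of_length (X : sgraph) (x y : X) (k : nat) : bool :=
  [exists p : k.-tuple X, path (@adj X) x p && (last x p == y)].

(* Least length of a walk from x to y; a shortest walk has length < #|X|, so
   the search bound loses nothing, and #|X| is a dummy value for unreachable
   pairs (never attained in a connected graph). *)
Definition dist (X : sgraph) (x y : X) : nat :=
  find (walk_of_length x y) (iota 0 #|X|).

Definition resolving (X : sgraph) (W : {set X}) : Prop :=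
  forall x y : X, x != y -> exists2 z, z \in W & dist x z != dist y z.

Section LexProduct.
Variables G H : sgraph.

Definition lex_adj : rel (G * H) := fun u v =>
  adj u.1 v.1 || (u.1 == v.1) && adj u.2 v.2.

Lemma lex_adj_sym : symmetric lex_adj.
Proof.
by move=> u v; rewrite /lex_adj adj_sym eq_sym [adj u.2 _]adj_sym.
Qed.

Lemma lex_adj_irrefl : irreflexive lex_adj.
Proof. by move=> u; rewrite /lex_adj !adj_irrefl andbF. Qed.

Definition lex_product : sgraph := SGraph lex_adj_sym lex_adj_irrefl.
End LexProduct.

Inductive player := Resolver | Spoiler.

Definition is_resolver (p : player) : bool :=
  if p is Resolver then true else false.
Definition player_of_bool (b : bool) : player :=
  if b then Resolver else Spoiler.
Lemma is_resolverK : cancel is_resolver player_of_bool.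
Proof. by case. Qed.
HB.instance Definition _ := Equality.copy player (can_type is_resolverK).

Definition opponent (p : player) : player :=
  if p is Resolver then Spoiler else Resolver.

(* The player making move number k (counted from 0). *)
Definition mover (first : player) (k : nat) : player :=
  if odd k then opponent first else first.

Section Game.
Variable X : sgraph.
Implicit Types (p first : player) (s h : seq X).

(* A position or play is the duplicate-free sequence of vertices selected so
   far, in chronological order. *)
Definition selected first p s : {set X} :=
  [set x in s | mover first (index x s) == p].

Definition wins first p s : Prop :=
  match p with
  | Resolver => exists2 W : {set X},
      resolving W & W \subset selected first Resolver s
  | Spoiler => forall W : {set X}, resolving W ->
      exists2 x, x \in W & x \in selected first Spoiler s
  end.

Definition complete_play s : Prop := uniq s /\ size s = #|X|.

Definition strategy := seq X -> X.

Definition legal first p (sigma : strategy) : Prop :=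
  forall h, uniq h -> size h < #|X| -> mover first (size h) = p ->
    sigma h \notin h.

Definition follows first p (sigma : strategy) s : Prop :=
  forall h x, prefix (rcons h x) s -> mover first (size h) = p ->
    x = sigma h.

(* Both winning conditions are preserved by further moves, so a game that is
   won early may be played on until every vertex is selected. *)
Definition has_winning_strategy first p : Prop :=
  exists sigma : strategy, legal first p sigma /\
    forall s, complete_play s -> follows first p sigma s -> wins first p s.
End Game.

Inductive outcome := OutR | OutN | OutS.

Definition has_outcome (X : sgraph) (o : outcome) : Prop :=
  match o with
  | OutR => forall first, has_winning_strategy X first Resolver
  | OutS => forall first, has_winning_strategy X first Spoiler
  | OutN => forall first, has_winning_strategy X first first
  end.

(* Main.v *)
Require Import Defs.
From mathcomp Require Import all_boot.

(** Inside a single copy [{g} x H] of [H], two vertices are separated only by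
    vertices of that same copy, and distances there are distances of [H]
    truncated at 2.  Hence a resolving set of the product meets every copy in
    a resolving set of [H], and Spoiler wins as soon as she hits all resolving
    sets of [H] within one copy.  Both outcomes N and S let her do so when she
    moves first, so she plays that strategy in a copy Resolver has not touched:
    there is one even after an opening move of Resolver because [G] has two
    vertices.  Whenever Resolver plays outside the copy she makes an arbitrary
    extra move, which never harms her. *)

Set Implicit Arguments.
Unset Strict Implicit.
Unset Printing Implicit Defensive.

(** * Spoiler's positional game *)

(* [F] is the set of unplayed vertices, of cardinality [n], [S] the set of
   Spoiler's vertices and [P] her (monotone) goal; Resolver's vertices need
   not be recorded. *)
Fixpoint spoiler_wins (T : finType) (P : pred {set T}) (p : player) (n : nat)
    (F S : {set T}) : bool :=
  if n is n'.+1 then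
    match p with
    | Spoiler => [exists x in F, spoiler_wins P Resolver n' (F :\ x) (x |: S)]
    | Resolver => [forall x in F, spoiler_wins P Spoiler n' (F :\ x) S]
    end
  else P S.

Definition monotone (T : finType) (P : pred {set T}) : Prop :=
  forall A B : {set T}, A \subset B -> P A -> P B.

(** Spoiler's final set is always contained in [F :|: S]. This settles a simulated game that still
    has free vertices when the real board is full. *)
Lemma spoiler_wins_goal (T : finType) (P : pred {set T}) p n (F S : {set T}) :
  monotone P -> #|F| = n -> spoiler_wins P p n F S -> P (F :|: S).
Proof.
move=> monoP; elim: n p F S => [|n IHn] p F S cardF /=.
  by move=> PS; apply: monoP PS; exact: subsetUr.
have cardD x : x \in F -> #|F :\ x| = n.
  by move=> Fx; move: cardF; rewrite (cardsD1 x) Fx => -[].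
case: p => [/forall_inP win | /exists_inP[x Fx win]].
- have /card_gt0P[x Fx]: 0 < #|F| by rewrite cardF.
  apply: monoP (IHn _ _ _ (cardD _ Fx) (win x Fx)).
  by apply: setSU; exact: subsetDl.
- apply: monoP (IHn _ _ _ (cardD _ Fx) win).
  by rewrite setUA; apply: setSU; rewrite subUset subsetDl sub1set.
Qed.

Section Transfer.
Variables (T T' : finType) (f : T' -> T).
Variables (P : pred {set T}) (P' : pred {set T'}).
Hypothesis f_inj : injective f.
Hypothesis monoP' : monotone P'.
Hypothesis P'P : forall S : {set T}, P' (f @^-1: S) -> P S.

(* Spoiler may already own vertices that are still unplayed in the game on
   [T']: these come from her extra moves. *)
Let compat (F S : {set T}) (F' S' : {set T'}) : Prop :=
  (forall x, x \in S' -> f x \in S) /\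
  (forall x, x \in F' -> (f x \in F) || (f x \in S)).

(** Joint induction on the free vertices of the real board. When the simulated game waits for
    Resolver, the real turn may be anyone's, since his outside moves are not simulated; hence the
    arbitrary [p] in the first half. *)
Lemma spoiler_wins_transfer_both n :
  (forall p (F S : {set T}) (F' S' : {set T'}), #|F| = n -> compat F S F' S' ->
     spoiler_wins P' Resolver #|F'| F' S' -> spoiler_wins P p n F S) /\
  (forall (F S : {set T}) (F' S' : {set T'}), #|F| = n -> compat F S F' S' ->
     spoiler_wins P' Spoiler #|F'| F' S' -> spoiler_wins P Spoiler n F S).
Proof.
elim/ltn_ind: n => n IH.
have cardD m (U : finType) (A : {set U}) x : #|A| = m.+1 -> x \in A -> #|A :\ x| = m.
  by move=> cardA Ax; move: cardA; rewrite (cardsD1 x) Ax => -[].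
have resolver_to_move p (F S : {set T}) (F' S' : {set T'}) :
    #|F| = n -> compat F S F' S' ->
    spoiler_wins P' Resolver #|F'| F' S' -> spoiler_wins P p n F S.
  case: n IH => [|n] IH cardF [S'S F'FS] win' /=.
    have PFS := spoiler_wins_goal monoP' erefl win'.
    apply/P'P; apply: monoP' PFS; apply/subsetP=> x; rewrite !inE.
    case/orP=> [/F'FS|/S'S//].
    by move/cards0_eq: cardF => ->; rewrite inE.
  have [IH1 IH2] := IH n (ltnSn n).
  case: p.
  - apply/forall_inP=> y Fy; have cardFy := cardD _ _ _ _ cardF Fy.
    (* A move of Resolver onto the image of a free vertex is copied into the simulation; any other
       leaves the simulation waiting for him. *)
    case: (pickP [pred x in F' | f x == y]) => [x /andP[F'x /eqP fx] | out].
    + apply: (IH2 _ _ (F' :\ x) S' cardFy).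
        split=> [//|z]; rewrite !inE => /andP[zx /F'FS].
        by rewrite -fx (inj_eq f_inj) zx.
      have cardF' : #|F'| = #|F' :\ x|.+1 by rewrite (cardsD1 x) F'x.
      by move: win'; rewrite cardF' => /= /forall_inP; apply.
    + apply: (IH1 _ _ _ F' S' cardFy) win'; split=> [//|z F'z].
      have := out z; rewrite /= F'z /= => fz; rewrite !inE fz; exact: F'FS.
  (* Spoiler's extra move: [F'] stays as it is, even if [x] is the image of one of its vertices. *)
  - have /card_gt0P[x Fx]: 0 < #|F| by rewrite cardF.
    apply/exists_inP; exists x => //.
    apply: (IH1 _ _ _ F' S' (cardD _ _ _ _ cardF Fx)) win'.
    split=> z; rewrite !inE; first by move/S'S->; rewrite orbT.
    by move/F'FS; case: (f z == x).
split=> // F S F' S' cardF [S'S F'FS].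
case E: #|F'| => [|m] win'.
  by apply: (resolver_to_move _ F S F' S') => //; rewrite E.
case/exists_inP: win' => x F'x.
rewrite -(cardD _ _ _ _ E F'x) => win'.
have [Fx|nFx] := boolP (f x \in F); last first.
  apply: resolver_to_move cardF _ win'; split=> z; rewrite !inE.
    case/orP=> [/eqP->|/S'S//]; by have := F'FS x F'x; rewrite (negPf nFx).
  by case/andP=> _ /F'FS.
case: n cardF IH {resolver_to_move} => [/cards0_eq F0|n cardF IH].
  by move: Fx; rewrite F0 inE.
apply/exists_inP; exists (f x) => //.
have [IH1 _] := IH n (ltnSn n).
apply: IH1 (cardD _ _ _ _ cardF Fx) _ win'; split=> z; rewrite !inE.
  by case/orP=> [/eqP->|/S'S->]; rewrite ?eqxx ?orbT.
by case/andP=> zx /F'FS; rewrite (inj_eq f_inj) (negPf zx).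
Qed.

Lemma spoiler_wins_transfer (F : {set T}) :
  (forall x, f x \in F) ->
  spoiler_wins P' Spoiler #|T'| setT set0 ->
  spoiler_wins P Spoiler #|F| F set0.
Proof.
rewrite -cardsT => fF; apply: (spoiler_wins_transfer_both _).2 => //.
by split=> x; rewrite ?inE // fF.
Qed.
End Transfer.

(** * Positional game and strategies *)

Section Strategies.
Variable X : sgraph.
Implicit Types (p first : player) (s h : seq X).

Definition resolvingb (W : {set X}) : bool :=
  [forall x, forall y, (x != y) ==> [exists z in W, dist x z != dist y z]].

Lemma resolvingP (W : {set X}) : reflect (resolving W) (resolvingb W).
Proof.
apply: (iffP 'forall_forallP) => [res x y xy | res x y].
  by have /implyP/(_ xy)/exists_inP := res x y.
by apply/implyP=> xy; apply/exists_inP; exact: res.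
Qed.

Definition hits_resolving (S : {set X}) : bool :=
  [forall W, resolvingb W ==> [exists x in W, x \in S]].

Lemma hits_resolvingP (S : {set X}) :
  reflect (forall W : {set X}, resolving W -> exists2 x, x \in W & x \in S)
          (hits_resolving S).
Proof.
apply: (iffP forallP) => [hit W /resolvingP resW | hit W].
  by have /implyP/(_ resW)/exists_inP := hit W.
by apply/implyP=> /resolvingP/hit ?; apply/exists_inP.
Qed.

Lemma hits_resolving_mono : monotone hits_resolving.
Proof.
move=> A B /subsetP sAB /hits_resolvingP hit; apply/hits_resolvingP=> W resW.
by have [x Wx Ax] := hit W resW; exists x => //; exact: sAB.
Qed.

Definition spoiler_wins_from first h : bool :=
  spoiler_wins hits_resolving (mover first (size h)) (#|X| - size h)
    (~: [set x in h]) (selected first Spoiler h).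

Lemma selected_rcons first p h x : x \notin h ->
  selected first p (rcons h x) =
  if mover first (size h) == p then x |: selected first p h
  else selected first p h.
Proof.
move=> hx; apply/setP=> y; rewrite !inE mem_rcons inE -cats1 index_cat.
have [->|yx] := eqVneq y x.
  rewrite (negPf hx) /= eqxx addn0.
  by case: ifP => mp; rewrite !inE ?eqxx // (negPf hx).
by case: (mover _ (size h) == p); rewrite !inE ?(negPf yx) /=; case: (y \in h).
Qed.

Lemma mover_rcons first h x :
  mover first (size (rcons h x)) = opponent (mover first (size h)).
Proof. by rewrite size_rcons /mover /=; case: odd; case: first. Qed.

Lemma setC_rcons h x : ~: [set y in rcons h x] = (~: [set y in h]) :\ x.
Proof. by apply/setP=> y; rewrite !inE mem_rcons inE negb_or. Qed.

Lemma spoiler_wins_from_end first h : size h = #|X| ->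
  spoiler_wins_from first h = hits_resolving (selected first Spoiler h).
Proof. by move=> sz; rewrite /spoiler_wins_from sz subnn. Qed.

Lemma spoiler_wins_from_spoiler first h : size h < #|X| ->
  mover first (size h) = Spoiler ->
  spoiler_wins_from first h =
  [exists x, (x \notin h) && spoiler_wins_from first (rcons h x)].
Proof.
move=> sz mv; rewrite /spoiler_wins_from mv -(subnSK sz) /=.
apply: eq_existsb => x; rewrite !inE; apply: andb_id2l => hx.
by rewrite mover_rcons mv size_rcons setC_rcons selected_rcons // mv eqxx.
Qed.

Lemma spoiler_wins_from_resolver first h : size h < #|X| ->
  mover first (size h) = Resolver ->
  spoiler_wins_from first h =
  [forall x, (x \notin h) ==> spoiler_wins_from first (rcons h x)].
Proof.
move=> sz mv; rewrite /spoiler_wins_from mv -(subnSK sz) /=.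
apply: eq_forallb => x; rewrite !inE; apply: implyb_id2l => hx.
by rewrite mover_rcons mv size_rcons setC_rcons selected_rcons // mv.
Qed.

Lemma spoiler_wins_from_nil first :
  spoiler_wins_from first [::] =
  spoiler_wins hits_resolving first #|X| setT set0.
Proof.
rewrite /spoiler_wins_from subn0; congr spoiler_wins.
by apply/setP=> x; rewrite !inE.
Qed.

Lemma follows_rcons first p (sigma : strategy X) h x :
  follows first p sigma h ->
  (mover first (size h) = p -> x = sigma h) ->
  follows first p sigma (rcons h x).
Proof.
move=> fol hx k y /prefixP[t]; case/lastP: t => [|t z].
  by rewrite cats0 => /rcons_inj[<- <-].
rewrite -rcons_cat => /rcons_inj[eh _]; apply: fol.
by apply/prefixP; exists t.
Qed.

Lemma winning_strategy_spoiler_wins first :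
  has_winning_strategy X first Spoiler ->
  spoiler_wins hits_resolving first #|X| setT set0.
Proof.
case=> sigma [leg win]; rewrite -spoiler_wins_from_nil.
suff main n h : n = #|X| - size h -> uniq h -> size h <= #|X| ->
    follows first Spoiler sigma h -> spoiler_wins_from first h.
  by apply: (main _ [::] erefl) => // h x; case: h.
elim: n h => [|n IHn] h En uh sz fol.
  have {En}sz : size h = #|X|.
    by apply/eqP; rewrite eqn_leq sz -subn_eq0 -En.
  rewrite spoiler_wins_from_end //; apply/hits_resolvingP.
  exact: (win h (conj uh sz) fol).
have lt : size h < #|X| by rewrite -subn_gt0 -En.
have step x : x \notin h -> (mover first (size h) = Spoiler -> x = sigma h) ->
    spoiler_wins_from first (rcons h x).
  move=> hx sx; apply: IHn; rewrite ?size_rcons ?rcons_uniq ?hx //.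
    by rewrite subnS -En.
  exact: follows_rcons.
case mv: (mover first (size h)).
  rewrite spoiler_wins_from_resolver //; apply/forallP=> x.
  by apply/implyP=> hx; apply: step => //; rewrite mv.
rewrite spoiler_wins_from_spoiler //; apply/existsP; exists (sigma h).
by have hs := leg h uh lt mv; rewrite hs step.
Qed.

Lemma spoiler_wins_winning_strategy first (x0 : X) :
  spoiler_wins hits_resolving first #|X| setT set0 ->
  has_winning_strategy X first Spoiler.
Proof.
rewrite -spoiler_wins_from_nil => win0.
(* Spoiler moves to a winning position when there is one; the fallback only secures legality
   elsewhere, and [x0] is returned only on a full board. *)
pose sigma h :=
  if [pick x | (x \notin h) && spoiler_wins_from first (rcons h x)] is Some x
  then x else odflt x0 [pick x | x \notin h].
exists sigma; split=> [h uh lt _ | s [us szs] fol].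
  rewrite /sigma; case: pickP => [x /andP[] //|_].
  case: pickP => [//|full] /=.
  have allh : h =i X by move=> x; rewrite inE; exact: negbFE (full x).
  by move: lt; rewrite -(card_uniqP uh) (eq_card allh) ltnn.
have win k : k <= size s -> spoiler_wins_from first (take k s).
  elim: k => [|k IHk] ks; first by rewrite take0.
  have {IHk} := IHk (ltnW ks); have szk := size_takel (ltnW ks).
  have lt : size (take k s) < #|X| by rewrite szk -szs.
  rewrite (take_nth x0 ks); set x := nth x0 s k; set h := take k s in szk lt *.
  have pre : prefix (rcons h x) s by rewrite -(take_nth x0 ks) prefix_take.
  have hx : x \notin h.
    by have := prefix_uniq pre us; rewrite rcons_uniq => /andP[].
  case mv: (mover first (size h)).
    by rewrite spoiler_wins_from_resolver // => /forallP/(_ x)/implyP; apply.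
  rewrite spoiler_wins_from_spoiler // => /existsP[y Hy].
  rewrite (fol h x pre mv) /sigma; case: pickP => [z /andP[] //|/(_ y)].
  by rewrite Hy.
have := win _ (leqnn _); rewrite take_size spoiler_wins_from_end //.
by move/hits_resolvingP.
Qed.
End Strategies.

(** * Distances in the lexicographic product *)

Lemma walk_of_length0 (X : sgraph) (x y : X) : walk_of_length x y 0 = (x == y).
Proof.
apply/existsP/idP => [[p]|xy]; first by rewrite tuple0.
by exists [tuple]; rewrite /= xy.
Qed.

Lemma walk_of_lengthS (X : sgraph) (x y : X) k :
  walk_of_length x y k.+1 = [exists z, adj x z && walk_of_length z y k].
Proof.
apply/existsP/existsP => [[p]|[z /andP[xz /existsP[p walk]]]].
  case/tupleP: p => z p /= /andP[/andP[xz walk] end_y].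
  by exists z; rewrite xz; apply/existsP; exists p; rewrite walk.
by exists [tuple of z :: p]; rewrite /= xz.
Qed.

Lemma walk_of_length1 (X : sgraph) (x y : X) : walk_of_length x y 1 = adj x y.
Proof.
rewrite walk_of_lengthS; apply/existsP/idP => [[z]|xy].
  by rewrite walk_of_length0 => /andP[xz /eqP <-].
by exists y; rewrite xy walk_of_length0 eqxx.
Qed.

(** With two vertices or more, the search in [dist] tests lengths 0 and 1, so the values 0 and 1
    encode equality and adjacency. *)
Lemma eq_dist_near (X : sgraph) (x y z : X) : 2 <= #|X| ->
  dist x z = dist y z -> (x == z) = (y == z) /\ adj x z = adj y z.
Proof.
rewrite /dist; case: #|X| => [//|[//|m]] _ /=.
rewrite !walk_of_length0 !walk_of_length1.
have [->|_] := eqVneq x z; have [->|_] := eqVneq y z => //.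
by case: (adj x z); case: (adj y z).
Qed.

Lemma connected_neighbour (X : sgraph) (x : X) :
  connected X -> 2 <= #|X| -> exists y, adj x y.
Proof.
move=> con; rewrite -cardsT (cardsD1 x) inE ltnS => /card_gt0P[y].
rewrite !inE andbT => yx; have /connectP[[|z p] /=] := con x y.
  by move=> _ eyx; rewrite eyx eqxx in yx.
by case/andP=> xz _ _; exists z.
Qed.

Section LexDistance.
Variables G H : sgraph.
Hypotheses (conG : connected G) (conH : connected H).
Hypotheses (cardG : 2 <= #|G|) (cardH : 2 <= #|H|).
Notation GH := (lex_product G H).

(** Until the walk leaves the copy of [g], its steps are replaced by arbitrary edges inside that
    copy; the leaving step can then be kept, since edges between copies ignore the second
    coordinate. *)
Lemma lex_walk_other_copy (g : G) (h h' : H) (z : GH) k : z.1 != g ->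
  walk_of_length ((g, h) : GH) z k -> walk_of_length ((g, h') : GH) z k.
Proof.
move=> zg; elim: k h h' => [|k IHk] h h'.
  by rewrite walk_of_length0 => /eqP ez; rewrite -ez eqxx in zg.
rewrite !walk_of_lengthS => /existsP[[g2 h2] /andP[/= e walk]].
apply/existsP; have [ggs|ngg] := boolP (adj g g2).
  by exists (g2, h2); rewrite walk /= /lex_adj /= ggs.
move: e; rewrite /lex_adj /= (negPf ngg) /= => /andP[/eqP eg _].
rewrite -eg in walk.
have [h'' e''] := connected_neighbour h' conH cardH.
by exists (g, h''); rewrite (IHk _ h'' walk) /= /lex_adj /= eqxx e'' orbT.
Qed.

(** Waste [n] steps inside the copy, then go to a neighbouring copy and back. *)
Lemma lex_walk_same_copy (g : G) (h k : H) n :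
  walk_of_length ((g, h) : GH) (g, k) n.+2.
Proof.
elim: n h => [|n IHn] h; rewrite walk_of_lengthS; apply/existsP.
  have [g' e] := connected_neighbour g conG cardG.
  by exists (g', h); rewrite walk_of_length1 /= /lex_adj /= e adj_sym e.
have [h' e] := connected_neighbour h conH cardH.
by exists (g, h'); rewrite IHn /= /lex_adj /= eqxx e orbT.
Qed.

Lemma resolving_copy (W : {set GH}) (g : G) :
  resolving W -> resolving [set h : H | (g, h) \in W].
Proof.
move=> resW h h' hh'.
have /resW[[g1 k] Wz] : ((g, h) : GH) != (g, h').
  by apply: contraNneq hh' => -[->].
have [g1g | gg] := eqVneq g1 g; last first.
  case/eqP; apply: eq_find => n.
  by apply/idP/idP; apply: lex_walk_other_copy.
rewrite g1g in Wz * => dGH; exists k; first by rewrite inE.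
(* If [k] does not separate [h] and [h'] in [H], walks to it of lengths 0 and 1 agree in the
   product, and longer ones always exist. *)
apply: contraNneq dGH => /(eq_dist_near cardH)[eqk adjk].
apply/eqP/eq_find; case=> [|[|n]]; last by rewrite !lex_walk_same_copy.
  by rewrite !walk_of_length0 !xpair_eqE eqk.
by rewrite !walk_of_length1 /= /lex_adj /= adjk.
Qed.

Lemma hits_resolving_copy (g : G) (S : {set GH}) :
  hits_resolving [set h : H | (g, h) \in S] -> hits_resolving S.
Proof.
move/hits_resolvingP=> hit; apply/hits_resolvingP=> W /(resolving_copy g)/hit.
by case=> h; rewrite !inE => Wh Sh; exists (g, h).
Qed.
End LexDistance.

Theorem theorem3p2 (G H : sgraph)
  (conG : connected G) (conH : connected H)
  (cardG : 2 <= #|G|) (cardH : 2 <= #|H|)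
  (oH : has_outcome H OutN \/ has_outcome H OutS) :
  has_outcome (lex_product G H) OutS.
Proof.
have /winning_strategy_spoiler_wins winH : has_winning_strategy H Spoiler Spoiler.
  by case: oH; apply.
have /card_gt0P[g0 _] : 0 < #|G| by apply: leq_trans cardG.
have /card_gt0P[h0 _] : 0 < #|H| by apply: leq_trans cardH.
have win_copy (g : G) (F : {set lex_product G H}) : (forall h, (g, h) \in F) ->
    spoiler_wins (@hits_resolving _) Spoiler #|F| F set0.
  move=> gF; apply: (spoiler_wins_transfer (f := pair g) _ _ _ gF winH).
  - by move=> h h' [].
  - exact: hits_resolving_mono.
  - by move=> S; apply: hits_resolving_copy.
move=> first; apply: (spoiler_wins_winning_strategy ((g0, h0) : lex_product G H)).
rewrite -cardsT; case: first; last by apply: (win_copy g0) => h; rewrite inE.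
have cardD y : #|[set: lex_product G H]| = #|[set: lex_product G H] :\ y|.+1.
  by rewrite (cardsD1 y) inE.
(* The vertex [(g0, h0)] only exposes a successor; the count is recast below in terms of the actual
   opening move [y]. *)
rewrite (cardD (g0, h0)) /=; apply/forall_inP=> y _.
(* A neighbour of [y.1] differs from it, so its copy is untouched. *)
have [g e] := connected_neighbour y.1 conG cardG.
rewrite -[X in spoiler_wins _ _ X]/(_.+1.-1) -cardD (cardD y).
apply: (win_copy g) => h; rewrite !inE andbT.
by apply: contraTneq e => <-; rewrite adj_irrefl.
Qed.
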